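(* For all points $A,B,C$: $\mathrm{Bet}(A,B,C)$ holds if and only if ($B$ and $C$ lie on the same half-line from $A$) and ($B$ and $A$ lie on the same half-line from $C$).
   Context: Synthetic plane geometry with classical logic. Primitive notions: points, lines (with equality), incidence $A\in x$, a ternary betweenness relation $\mathrm{Bet}(A,B,C)$ on points (''$B$ strictly between $A$ and $C$''), lengths with a map $(A,B)\mapsto|AB|$. Points are collinear if some line contains all of them. Axioms: (incidence) there is a point; for every point there is a distinct point; every line has a point; for every line $x$ and $A\in x$ there is $B\in x$, $B\neq A$; for every line there is a point not on it; through two distinct points there is a line; if $A\neq B$, $A,B\in x$ and $x\neq y$ then $A\notin y$ or $B\notin y$. (betweenness) if $\mathrm{Bet}(A,B,C)$ then $A\neq C$, $A,B,C$ are collinear, $\mathrm{Bet}(C,B,A)$, and not $\mathrm{Bet}(B,A,C)$. (lengths) $|AB|=|CC|$ iff $A=B$; $|AB|=|BA|$. (line–circle) for $O,A,B$ with $A\neq O$ there is $C$ with ($\mathrm{Bet}(A,O,C)$ or $O=C$) and $|OB|=|OC|$. ''$A,B$ lie on opposite sides of line $x$'': $A,B\notin x$ and some $O\in x$ has $\mathrm{Bet}(A,O,B)$. (Pasch) if $A,B$ lie on opposite sides of $x$ and $C\notin x$, then $A,C$ or $C,B$ lie on opposite sides of $x$. Definition: ''$P$ and $Q$ lie on the same half-line from $O$'' means $O\neq P$, $O\neq Q$, $O,P,Q$ are collinear, and not $\mathrm{Bet}(P,O,Q)$. *)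

(* Defs.v *)
Set Implicit Arguments.
Unset Strict Implicit.
Unset Printing Implicit Defensive.

(* Equality of points, of lines and of lengths is Leibniz equality. *)
Record plane_signature : Type := PlaneSignature {
  point : Type;
  line : Type;
  length : Type;
  on_line : point -> line -> Prop;
  bet : point -> point -> point -> Prop;  (* the middle argument is strictly between the others *)
  len : point -> point -> length
}.

Section Definitions.
Context {G : plane_signature}.
Implicit Types (A B C O P Q : point G) (x : line G).

Definition collinear A B C : Prop :=
  exists x, on_line A x /\ on_line B x /\ on_line C x.

Definition opposite_sides x A B : Prop :=
  ~ on_line A x /\ ~ on_line B x /\ exists O, on_line O x /\ bet A O B.

(* [P] and [Q] lie on the same half-line from the first argument [O]. *)
Definition same_half_line O P Q : Prop :=
  O <> P /\ O <> Q /\ collinear O P Q /\ ~ bet P O Q.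

End Definitions.

Record plane_geometry : Type := PlaneGeometry {
  signature_of :> plane_signature;

  point_exists : exists A : point signature_of, True;
  distinct_point_exists :
    forall A : point signature_of, exists B : point signature_of, B <> A;
  line_has_point :
    forall x : line signature_of, exists A, on_line A x;
  line_has_other_point :
    forall (x : line signature_of) (A : point signature_of),
      on_line A x -> exists B, on_line B x /\ B <> A;
  point_off_line_exists :
    forall x : line signature_of, exists A, ~ on_line A x;
  line_through :
    forall A B : point signature_of,
      A <> B -> exists x, on_line A x /\ on_line B x;
  line_unique :
    forall (A B : point signature_of) (x y : line signature_of),
      A <> B -> on_line A x -> on_line B x -> x <> y ->
      ~ on_line A y \/ ~ on_line B y;

  bet_neq :
    forall A B C : point signature_of, bet A B C -> A <> C;
  bet_collinear :
    forall A B C : point signature_of, bet A B C -> collinear A B C;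
  bet_sym :
    forall A B C : point signature_of, bet A B C -> bet C B A;
  bet_asym :
    forall A B C : point signature_of, bet A B C -> ~ bet B A C;

  len_null :
    forall A B C : point signature_of, len A B = len C C <-> A = B;
  len_sym :
    forall A B : point signature_of, len A B = len B A;

  line_circle :
    forall O A B : point signature_of, A <> O ->
      exists C, (bet A O C \/ O = C) /\ len O B = len O C;

  pasch :
    forall (x : line signature_of) (A B C : point signature_of),
      opposite_sides x A B -> ~ on_line C x ->
      opposite_sides x A C \/ opposite_sides x C B
}.

(* Main.v *)
(** The direct implication is immediate from the asymmetry of betweenness.  For
the converse one must show that of three distinct points of a line [m] one lies
between the other two.  Suppose that neither [A] nor [C] does.  Take [D] off [m]
and extend [BD] beyond [D] to [H].  Pasch for [BH], crossed by the line [AD],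
gives [E] on [AD] between [C] and [H]; Pasch for [BH], crossed by [CD], separates
[A] from [H], and then from [E], by [CD], so [D] is between [A] and [E].  Finally
the line [BD] separates [A] from [E] but not [E] from [C], hence [A] from [C],
and it meets [m] at [B]. *)
Require Import Defs.
From Stdlib Require Import Classical.

Section Plane.
Local Set Implicit Arguments.
Local Unset Strict Implicit.
Context {G : plane_geometry}.
Implicit Types (A B C O P Q R : point G) (x y : line G).

Lemma line_eq P Q x y :
  P <> Q -> on_line P x -> on_line Q x -> on_line P y -> on_line Q y -> x = y.
Proof.
  intros nPQ Px Qx Py Qy. apply NNPP. intros nxy.
  destruct (line_unique nPQ Px Qx nxy); contradiction.
Qed.

(** Two distinct lines share at most one point; here [R] witnesses that [x] and [y] differ, and [P]
    is their common point. *)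
Lemma off_line_of_meet P Q R x y :
  P <> Q -> on_line P x -> on_line Q x -> on_line R x ->
  on_line P y -> ~ on_line R y -> ~ on_line Q y.
Proof.
  intros nPQ Px Qx Rx Py nRy Qy. apply nRy.
  now rewrite <- (line_eq nPQ Px Qx Py Qy).
Qed.

Lemma bet_distinct A B C : bet A B C -> A <> B /\ B <> C /\ A <> C.
Proof.
  intros b. repeat split.
  - intros ->. exact (bet_asym b b).
  - intros ->. apply bet_sym in b. exact (bet_asym b b).
  - exact (bet_neq b).
Qed.

Lemma bet_on_line A B C x :
  bet A B C -> on_line A x -> on_line B x -> on_line C x.
Proof.
  intros b Ax Bx.
  destruct (bet_distinct b) as [nAB _].
  destruct (bet_collinear b) as (y & Ay & By & Cy).
  now rewrite (line_eq nAB Ax Bx Ay By).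
Qed.

Lemma bet_extend A O : A <> O -> exists C, bet A O C.
Proof.
  intros nAO.
  (* The circle about [O] passes through [A] itself, so the degenerate case [O = C] would give a
     null radius and [A = O]. *)
  destruct (line_circle A nAO) as (C & [b | <-] & e).
  - now exists C.
  - apply len_null in e. congruence.
Qed.

(** The line [y] leaves [x] at [P], so it meets [x] only once and the crossing point must be [R]. *)
Lemma opposite_sides_bet P Q R x y :
  opposite_sides x P Q -> on_line R x ->
  on_line P y -> on_line Q y -> on_line R y -> bet P R Q.
Proof.
  intros (nPx & nQx & O & Ox & b) Rx Py Qy Ry.
  destruct (classic (O = R)) as [<- | nOR]; [exact b |].
  exfalso. apply nPx.
  destruct (bet_collinear b) as (z & Pz & Oz & Qz).
  assert (Oy : on_line O y)
    by now rewrite (line_eq (bet_neq b) Py Qy Pz Qz).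
  now rewrite (line_eq nOR Ox Rx Oy Ry).
Qed.

Lemma bet_of_not_bet A B C :
  A <> B -> B <> C -> A <> C -> collinear A B C ->
  ~ bet B A C -> ~ bet B C A -> bet A B C.
Proof.
  intros nAB nBC nAC (m & Am & Bm & Cm) nBAC nBCA.
  destruct (point_off_line_exists m) as [D nDm].
  assert (off : forall P, on_line P m -> P <> D) by (intros P Pm ->; contradiction).
  destruct (line_through (off A Am)) as (ad & Aad & Dad).
  destruct (line_through (off B Bm)) as (bd & Bbd & Dbd).
  destruct (line_through (off C Cm)) as (cd & Ccd & Dcd).
  assert (off2 : forall P Q x, P <> Q -> on_line P m -> on_line Q m ->
                   on_line P x -> on_line D x -> ~ on_line Q x).
  { intros P Q x nPQ Pm Qm Px Dx Qx. apply nDm.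
    now rewrite (line_eq nPQ Pm Qm Px Qx). }
  assert (nBad : ~ on_line B ad) by (apply (off2 A); auto).
  assert (nCad : ~ on_line C ad) by (apply (off2 A); auto).
  assert (nAbd : ~ on_line A bd) by (apply (off2 B); auto).
  assert (nCbd : ~ on_line C bd) by (apply (off2 B); auto).
  assert (nAcd : ~ on_line A cd) by (apply (off2 C); auto).
  assert (nBcd : ~ on_line B cd) by (apply (off2 C); auto).
  destruct (bet_extend (off B Bm)) as [H bBDH].
  pose proof (bet_on_line bBDH Bbd Dbd) as Hbd.
  destruct (bet_distinct bBDH) as (_ & nDH & _).
  pose proof (off_line_of_meet nDH Dbd Hbd Bbd Dad nBad) as nHad.
  pose proof (off_line_of_meet nDH Dbd Hbd Bbd Dcd nBcd) as nHcd.
  assert (oad : opposite_sides ad B H) by (repeat split; eauto).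
  assert (ocd : opposite_sides cd B H) by (repeat split; eauto).
  (* The other alternative puts [A] between [B] and [C], which is excluded. *)
  destruct (pasch oad nCad) as [o | (_ & _ & E & Ead & bCEH)].
  { destruct nBAC. exact (opposite_sides_bet o Aad Bm Cm Am). }
  destruct (pasch ocd nAcd) as [o | oAH].
  { destruct nBCA. exact (opposite_sides_bet o Ccd Bm Am Cm). }
  destruct (bet_distinct bCEH) as (nCE & nEH & _).
  destruct (bet_collinear bCEH) as (k & Ck & Ek & Hk).
  pose proof (off_line_of_meet nCE Ck Ek Hk Ccd nHcd) as nEcd.
  pose proof (off_line_of_meet (not_eq_sym nEH) Hk Ek Ck Hbd nCbd) as nEbd.
  (* Were [E] and [H] separated by [cd], [C] would lie between them, against [bCEH]. *)
  destruct (pasch oAH nEcd) as [oAE | o].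
  2: { destruct (bet_asym bCEH). exact (opposite_sides_bet o Ccd Ek Hk Ck). }
  pose proof (opposite_sides_bet oAE Dcd Aad Ead Dad) as bADE.
  assert (obd : opposite_sides bd A E) by (repeat split; eauto).
  destruct (pasch obd nCbd) as [o | o].
  - exact (opposite_sides_bet o Bbd Am Cm Bm).
  (* Here [bd] would cross [CE] at [H], although [E] lies between [C] and [H]. *)
  - destruct (bet_asym (bet_sym bCEH)).
    exact (bet_sym (opposite_sides_bet o Hbd Ck Ek Hk)).
Qed.

Lemma bet_same_half_line A B C : bet A B C -> same_half_line A B C.
Proof.
  intros b. destruct (bet_distinct b) as (nAB & _ & nAC).
  repeat split; auto using bet_collinear, bet_asym.
Qed.

End Plane.

Theorem theorem7 (G : plane_geometry) (A B C : point G) :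
  bet A B C <-> same_half_line A B C /\ same_half_line C B A.
Proof.
  split.
  - intros b. split; apply bet_same_half_line; auto using bet_sym.
  - intros [(nAB & nAC & col & nBAC) (nCB & _ & _ & nBCA)].
    apply bet_of_not_bet; auto.
Qed.
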